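(* Let $\alpha\in\mathbb{Q}\cap(0,1/2)$ with $\alpha\ne1/3$, let $e_0,\dots,e_{n+1}$ be the edges of the funnel $F_\alpha$ and let $\omega_1,\dots,\omega_k$ be its hubs. Let $i\in\{1,\dots,k\}$ and let $e_j$, $2\le j\le n+1$, be a spoke for $\omega_i$. Then $A_i$, acting as a M\''obius transformation of $\mathbb{Q}(x)\cup\{\infty\}$, takes the triple $\delta_{j-1}=\delta(e_{j-1})$ to the triple $\delta'_j=\delta'(e_j)$, preserving the labeling of pairs by rational numbers. Also, $A_1$ takes the triple $\delta_0=\{0,1,\infty\}$ to the triple $\delta_1'$ so that the induced map on labels of pairs is $1/2\mapsto1/2$, $0\mapsto1$, $1\mapsto0$.
   Context: Farey notation. $\mathbb{Q}_0=\mathbb{Q}\cap[0,1]$, $\widehat{\mathbb{Q}}_0=\mathbb{Q}_0\cup\{\infty\}$; fractions are in lowest terms with positive denominator, $0=0/1$, $1=1/1$, $\infty=1/0$. A pair $\{p/q,r/s\}\subset\widehat{\mathbb{Q}}_0$ is a Farey pair if $ps-rq=\pm1$; $p/q\oplus r/s=(p+r)/(q+s)$; $\gamma\oplus^0\beta=\gamma$, $\gamma\oplus^j\beta=(\gamma\oplus^{j-1}\beta)\oplus\beta$. Edges. An edge is a Farey pair $e\subset\mathbb{Q}_0$, with endpoints $e^L<e^R$. For $e\neq\{0,1\}$, $e^-$ and $e^+$ are the endpoints with smaller and larger denominator, $\hat e\in\mathbb{Q}_0$ is determined by $\hat e\oplus e^-=e^+$, and $\nu(e)=-1$ if $e^-=e^L$,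 $\nu(e)=1$ if $e^-=e^R$. Polynomials. $d_{\mathcal Q}(p/q)=(-1)^px^q$. $\mathcal{Q},\mathcal{N}:\widehat{\mathbb{Q}}_0\to\mathbb{Z}[x]$ are the unique functions with $\mathcal{Q}(0)=1,\mathcal{Q}(\infty)=0,\mathcal{Q}(1)=1$, $\mathcal{N}(0)=\mathcal{N}(\infty)=\mathcal{N}(1)=1$, and $\mathcal{F}(\gamma\oplus^2\beta)=-d_{\mathcal Q}(\beta)\mathcal{F}(\gamma)+\mathcal{Q}(\beta)\mathcal{F}(\gamma\oplus\beta)$ for $\mathcal F\in\{\mathcal Q,\mathcal N\}$ and every Farey pair $\{\beta,\gamma\}$ with $\gamma\oplus^2\beta\in\mathbb{Q}_0$. Put $\mathcal{V}=\mathcal{N}/\mathcal{Q}$. Funnel and hubs. $F_\alpha$ has edges $e_0,\dots,e_{n+1}$: $e_0=\{0,1\}$; given $e_j$, let $c=e_j^L\oplus e_j^R$; if $c=\alpha$ stop and set $j=n+1$; if $\alpha<c$ then $e_{j+1}=\{e_j^L,c\}$; if $\alpha>c$ then $e_{j+1}=\{c,e_j^R\}$. A hub is a number of the form $e_j^-$ with $1\le j\le n+1$; the distinct hubs, in order of increasing denominator, are $\omega_1=0,\omega_2,\dots,\omega_k$. $e_j$ is a spoke for $\omega_i$ if $e_j^-=\omega_i$. A hub is on the left if it is the left endpoint $e_j^L$ of its spokes and on the right otherwise. Matrices. For $\omega\in\mathbb{Q}_0$ write $d=d_{\mathcal Q}(\omega)$, $Q=\mathcal{Q}(\omega)$, $N=\mathcal{N}(\omega)$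 and let, as M\''obius transformations (matrices up to scalar), $$T_\omega=\begin{bmatrix}NQ+d&-N^2\\Q^2&-NQ+d\end{bmatrix},\qquad S_\omega=\begin{bmatrix}-NQ+d&N^2-NQ+d\\-Q^2&-Q^2+NQ+d\end{bmatrix}.$$ Set $A_i=S_{\omega_i}$ if $\omega_i$ is on the left and $A_i=T_{\omega_i}$ otherwise. Triples. For an edge $e\neq\{0,1\}$ put $\varepsilon=-1$ if $\nu(e)=1$ and $\varepsilon=0$ if $\nu(e)=-1$, and $$\delta(e)=\{\varepsilon+\mathcal{V}(\hat e),\,-1+\mathcal{V}(e^L),\,\mathcal{V}(e^R)\},\qquad \delta'(e)=\{\mathcal{V}(e^-\oplus e^+),\,\mathcal{V}(e^-),\,\mathcal{V}(e^+)\}.$$ Refer to each element by the vertex ($\hat e$, $e^\pm$ or $e^-\oplus e^+$) at which $\mathcal{V}$ is evaluated. Labels of pairs in $\delta(e)$: the pair from $\hat e,e^-$ is labeled $e^+$; the pair from $\hat e,e^+$ is labeled $e^-$; the pair from $e^-,e^+$ is labeled $e^-\oplus e^+$. Labels of pairs in $\delta'(e)$: the pair from $e^-\oplus e^+,e^-$ is labeled $e^+$; the pair from $e^-\oplus e^+,e^+$ is labeled $e^-$; the pair from $e^-,e^+$ is labeled $\hat e$. For $\delta_0=\{0,1,\infty\}$ the labels are: $\{0,1\}$ is labeled $1/2$, $\{0,\infty\}$ is labeled $0$, $\{1,\infty\}$ is labeled $1$. *)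

(* Defs.v *)
From HB Require Import structures.
From mathcomp Require Import all_boot all_order all_algebra finmap.
From mathcomp Require Import zify ring lra.
Set Implicit Arguments. Unset Strict Implicit. Unset Printing Implicit Defensive.
Import Order.TTheory GRing.Theory Num.Theory.
Local Open Scope ring_scope.

(* Rationals extended by infinity = 1/0, which is [None]. *)
Definition Qhat := option rat.
Definition fin_Qhat (r : rat) : Qhat := Some r.
Coercion fin_Qhat : rat >-> Qhat.

Definition num (g : Qhat) : int := if g is Some r then numq r else 1.
Definition den (g : Qhat) : int := if g is Some r then denq r else 0.

Definition in_Q0 (g : Qhat) : bool := if g is Some r then 0 <= r <= 1 else false.
Definition in_Qhat0 (g : Qhat) : bool := if g is Some r then 0 <= r <= 1 else true.

Definition farey_pair (g b : Qhat) : bool :=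
  let D := num g * den b - num b * den g in (D == 1) || (D == -1).

(* On a Farey pair the fraction below is already in lowest terms and its
   denominator is positive, so that nothing is lost by reading it in [rat]. *)
Definition oplus (g b : Qhat) : rat := (num g + num b)%:~R / (den g + den b)%:~R.
Notation "g ⊕ b" := (oplus g b) (at level 50, left associativity) : ring_scope.
Definition oplusn (j : nat) (g b : Qhat) : Qhat :=
  iter j (fun g' => fin_Qhat (g' ⊕ b)) g.

Definition dQ (g : Qhat) : {poly int} :=
  (-1) ^+ `|num g|%N *: 'X^`|den g|%N.

Definition farey_recursive (Q F : Qhat -> {poly int}) : Prop :=
  forall b g : Qhat, in_Qhat0 b -> in_Qhat0 g -> farey_pair b g ->
    in_Q0 (oplusn 2 g b) ->
    F (oplusn 2 g b) = - dQ b * F g + Q b * F (oplusn 1 g b).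

(* [Q] and [N] are total on [Qhat]; only their values on rationals of [0,1] and
   at infinity are constrained, and only those are ever used. *)
Record is_QN (Q N : Qhat -> {poly int}) : Prop := IsQN {
  QN_Q0 : Q (0 : rat) = 1;
  QN_Qinf : Q None = 0;
  QN_Q1 : Q (1 : rat) = 1;
  QN_Qrec : farey_recursive Q Q;
  QN_N0 : N (0 : rat) = 1;
  QN_Ninf : N None = 1;
  QN_N1 : N (1 : rat) = 1;
  QN_Nrec : farey_recursive Q N
}.

(* The field Q(x), and Q(x) with a point [None] at infinity. *)
Definition Qx : fieldType := {fraction {poly rat}}.
Definition P1 : choiceType := option Qx.

Definition toQx (p : {poly int}) : Qx := tofrac (map_poly intr p).

Definition quot_P1 (a b : Qx) : P1 := if b == 0 then None else Some (a / b).
Definition shift_P1 (c : Qx) (z : P1) : P1 := omap (+%R c) z.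

Definition mx2 (a b c d : Qx) : 'M[Qx]_2 :=
  \matrix_(i, j) if i == 0 then (if j == 0 then a else b)
                 else (if j == 0 then c else d).

Definition moebius (A : 'M[Qx]_2) (z : P1) : P1 :=
  if z is Some t then quot_P1 (A 0 0 * t + A 0 1) (A 1 0 * t + A 1 1)
  else quot_P1 (A 0 0) (A 1 0).

(* An edge is represented by its endpoints (e^L, e^R). *)
Definition edge := (rat * rat)%type.
Definition eminus (e : edge) : rat := if denq e.1 < denq e.2 then e.1 else e.2.
Definition eplus (e : edge) : rat := if denq e.1 < denq e.2 then e.2 else e.1.
(* The solution of ehat e ⊕ eminus e = eplus e. *)
Definition ehat (e : edge) : rat :=
  (numq (eplus e) - numq (eminus e))%:~R / (denq (eplus e) - denq (eminus e))%:~R.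
Definition nu (e : edge) : int := if eminus e == e.1 then -1 else 1.

Section Funnel.
Variable alpha : rat.

Definition funnel_step (e : edge) : edge :=
  let c := e.1 ⊕ e.2 in if alpha < c then (e.1, c) else (c, e.2).

Definition funnel_edge (j : nat) : edge := iter j funnel_step (0, 1).

(* The edges of the funnel are [funnel_edge 0], ..., [funnel_edge m]. *)
Definition funnel_last (m : nat) : Prop :=
  (funnel_edge m).1 ⊕ (funnel_edge m).2 = alpha /\
  (forall j, (j < m)%N -> (funnel_edge j).1 ⊕ (funnel_edge j).2 <> alpha).

(* From here on [m] is the index of the last edge of the funnel. *)
Definition hubs (m : nat) : seq rat :=
  sort (fun a b => denq a <= denq b)
       (undup [seq eminus (funnel_edge j) | j <- iota 1 m]).

(* omega_i, for 1 <= i <= k = size (hubs m) *)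
Definition hub (m i : nat) : rat := nth 0 (hubs m) i.-1.

Definition spoke (m j : nat) (w : rat) : bool :=
  (1 <= j <= m)%N && (eminus (funnel_edge j) == w).

Definition hub_left (m : nat) (w : rat) : bool :=
  all (fun j => spoke m j w ==> ((funnel_edge j).1 == w)) (iota 1 m).

End Funnel.

(* A triple of points together with its pairs, each tagged by its label. *)
Record ltriple := LTriple {
  points : {fset P1};
  labels : {fset {fset P1} * rat}
}.

(* [f] takes the triple [t] to the triple [t'], and the pair labeled [l] to a
   pair labeled [s l]. *)
Definition takes (f : P1 -> P1) (s : rat -> rat) (t t' : ltriple) : Prop :=
  (f @` points t)%fset = points t' /\
  [fset ((f @` pl.1)%fset, s pl.2) | pl : {fset P1} * rat in labels t]%fset = labels t'.

Definition triple0 : ltriple :=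
  let z0 : P1 := Some 0 in let z1 : P1 := Some 1 in let zoo : P1 := None in
  LTriple [fset z0; z1; zoo]%fset
    [fset ([fset z0; z1]%fset, 1 / 2 : rat);
          ([fset z0; zoo]%fset, 0 : rat);
          ([fset z1; zoo]%fset, 1 : rat)]%fset.

Definition label_swap (l : rat) : rat := if l == 0 then 1 else if l == 1 then 0 else l.

Section Triples.
Variables Q N : Qhat -> {poly int}.

Definition calV (g : Qhat) : P1 := quot_P1 (toQx (N g)) (toQx (Q g)).

Definition Tmx (w : rat) : 'M[Qx]_2 :=
  let d := toQx (dQ w) in let q := toQx (Q w) in let n := toQx (N w) in
  mx2 (n * q + d) (- n ^+ 2)
      (q ^+ 2)    (- (n * q) + d).

Definition Smx (w : rat) : 'M[Qx]_2 :=
  let d := toQx (dQ w) in let q := toQx (Q w) in let n := toQx (N w) in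
  mx2 (- (n * q) + d) (n ^+ 2 - n * q + d)
      (- q ^+ 2)      (- q ^+ 2 + n * q + d).

Definition Amx (alpha : rat) (m i : nat) : 'M[Qx]_2 :=
  let w := hub alpha m i in if hub_left alpha m w then Smx w else Tmx w.

Section Edge.
Variable e : edge.

Definition delta_hat : P1 := shift_P1 (if nu e == 1 then -1 else 0) (calV (ehat e)).
(* The element of delta(e) coming from an endpoint v of e. *)
Definition delta_at (v : rat) : P1 :=
  if v == e.1 then shift_P1 (-1) (calV v) else calV v.

Definition delta : ltriple :=
  LTriple [fset delta_hat; delta_at e.1; delta_at e.2]%fset
    [fset ([fset delta_hat; delta_at (eminus e)]%fset, eplus e);
          ([fset delta_hat; delta_at (eplus e)]%fset, eminus e);
          ([fset delta_at (eminus e); delta_at (eplus e)]%fset,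
             eminus e ⊕ eplus e)]%fset.

Definition delta' : ltriple :=
  let c := eminus e ⊕ eplus e in
  LTriple [fset calV c; calV (eminus e); calV (eplus e)]%fset
    [fset ([fset calV c; calV (eminus e)]%fset, eplus e);
          ([fset calV c; calV (eplus e)]%fset, eminus e);
          ([fset calV (eminus e); calV (eplus e)]%fset, ehat e)]%fset.

End Edge.
End Triples.

(* The hypotheses [is_QN] and [funnel_last] can be met, and [ehat] solves its
   defining equation. *)

Lemma numden_div (n d u v : int) : 0 < d -> u * n + v * d = 1 ->
  numq (n%:~R / d%:~R) = n /\ denq (n%:~R / d%:~R) = d.
Proof.
move=> d0 h.
have co : coprimez n d by apply/coprimezP; exists (u, v).
have co' : coprime `|n|%N `|d|%N by move: co; rewrite /coprimez /gcdz /coprime; lia.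
rewrite coprimeq_num // coprimeq_den //; split; first by rewrite gtr0_sg // mul1r.
by case: eqP => [e|_]; lia.
Qed.

Lemma farey_oplus (g b : Qhat) : farey_pair b g -> 0 < den g + den b ->
  numq (g ⊕ b) = num g + num b /\ denq (g ⊕ b) = den g + den b.
Proof.
rewrite /farey_pair /oplus => /orP[] /eqP h p.
  by apply: (numden_div (u := - den b) (v := num b) p); rewrite -h; ring.
by apply: (numden_div (u := den b) (v := - num b) p); apply: oppr_inj; rewrite -h; ring.
Qed.

Lemma den_ge0 (g : Qhat) : 0 <= den g. Proof. by case: g => //= r; apply: ltW. Qed.

Lemma in_Q0_num (r : rat) : (0 <= r <= 1) = (0 <= numq r <= denq r).
Proof.
rewrite -numq_ge0; congr andb.
by rewrite -{1}(divq_num_den r) ler_pdivrMr ?ltr0z // mul1r ler_int.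
Qed.

Lemma in_Qhat0_num (g : Qhat) : in_Qhat0 g ->
  [/\ 0 <= num g, 0 <= den g & num g <= den g \/ (num g = 1 /\ den g = 0)].
Proof.
case: g => [r|] /=; last by move=> _; split=> //; right.
by rewrite in_Q0_num => /andP[h1 h2]; split=> //; left.
Qed.

Lemma Qhat_inj (g h : Qhat) : num g = num h -> den g = den h -> g = h.
Proof.
case: g h => [r|] [s|] //= e e'; last 2 first.
- by have := denq_gt0 r; lia.
- by have := denq_gt0 s; lia.
by congr Some; rewrite -(divq_num_den r) -(divq_num_den s) e e'.
Qed.

Definition parents (c b g : Qhat) : bool :=
  [&& in_Qhat0 b, in_Qhat0 g, farey_pair b g, in_Q0 (oplusn 2 g b)
    & oplusn 2 g b == c].

Lemma parentsP (c b g : Qhat) : parents c b g ->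
  [/\ in_Qhat0 b, in_Qhat0 g, farey_pair b g,
      [/\ num (oplusn 1 g b) = num g + num b, den (oplusn 1 g b) = den g + den b,
      num c = num g + num b *+ 2 & den c = den g + den b *+ 2] &
      0 < den b].
Proof.
case/and5P=> hb hg hf + /eqP <-.
case: (in_Qhat0_num hb) => nb db cb; case: (in_Qhat0_num hg) => ng dg cg.
have hp : 0 < den g + den b.
  by move: hf; rewrite /farey_pair => /orP[]/eqP; nia.
have [e1 e2] := farey_oplus hf hp.
rewrite /oplusn /iter.
have hf' : farey_pair b (fin_Qhat (g ⊕ b)).
  move: hf; rewrite /farey_pair /fin_Qhat /= e1 e2 => /orP[] /eqP h; apply/orP; [left|right];
  by rewrite -h; apply/eqP; ring.
have hp' : 0 < den (fin_Qhat (g ⊕ b)) + den b by rewrite /= e2; lia.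
have [e3 e4] := farey_oplus hf' hp'.
rewrite /in_Q0 /fin_Qhat in_Q0_num.
move=> h.
rewrite /fin_Qhat /= in e1 e2 e3 e4 hf' h *.
rewrite e3 e4 e1 e2 in h *.
split=> //; first by split=> //; lia.
by move: hf; rewrite /farey_pair => /orP[]/eqP; case: cb => ?; nia.
Qed.

Lemma mulz_small (q k x : int) : q * k = x -> - q < x -> x < q -> k = 0.
Proof.
move=> <- h1 h2; have q0 : 0 < q by lia.
have a : k < 1 by rewrite -(ltr_pM2l q0) mulr1.
have b : -1 < k by rewrite -(ltr_pM2l q0) mulrN1.
by lia.
Qed.

Lemma mulz_tight (q k x : int) : q * k = x -> 0 < x -> x <= q -> x = q.
Proof.
move=> <- h1 h2; have [q0|q0] := ltrP 0 q; last by lia.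
have a : k <= 1 by rewrite -(ler_pM2l q0) mulr1.
have b : 0 < k by rewrite -(ltr_pM2l q0) mulr0.
by rewrite (_ : k = 1) ?mulr1 //; lia.
Qed.

Lemma parents_uniq c b g b' g' : parents c b g -> parents c b' g' ->
  b = b' /\ g = g'.
Proof.
move=> /parentsP[hb hg hf [_ _ n1 d1] sb] /parentsP[hb' hg' hf' [_ _ n2 d2] sb'].
case: (in_Qhat0_num hb) => nb db cb; case: (in_Qhat0_num hg) => ng dg cg.
case: (in_Qhat0_num hb') => nb' db' cb'; case: (in_Qhat0_num hg') => ng' dg' cg'.
suff [e e'] : num b = num b' /\ den b = den b'.
  by split; apply: Qhat_inj => //; lia.
move: hf hf'; rewrite /farey_pair.
move: (num b) (den b) (num g) (den g) (num b') (den b') (num g') (den g')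
  (num c) (den c) n1 d1 n2 d2 sb sb' nb db cb ng dg cg nb' db' cb' ng' dg' cg'.
clear=> r s t u r' s' t' u' p q n1 d1 n2 d2 sb sb' nb db cb ng dg cg nb' db' cb' ng' dg' cg'.
have E : r * u - t * s = r * q - p * s by rewrite n1 d1; ring.
have E' : r' * u' - t' * s' = r' * q - p * s' by rewrite n2 d2; ring.
have pm (eps : int) : eps * eps = 1 -> eps = 1 \/ eps = -1.
    by move=> /eqP; rewrite -expr2 sqrf_eq1 => /orP[]/eqP; [left|right].
  have same (eps : int) : eps * eps = 1 -> r * q - p * s = eps -> r' * q - p * s' = eps ->
    r = r' /\ s = s'.
  move=> ee h h'.
  have k : q * (r * s' - r' * s) = eps * (s' - s).
    by transitivity ((r * q - p * s) * s' - (r' * q - p * s') * s);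
      [ring | rewrite h h'; ring].
  have hk : r * s' - r' * s = 0.
    by case: (pm eps ee) => pe; rewrite pe in k; apply: (mulz_small k); lia.
  have ss : s = s' by rewrite hk mulr0 in k; case: (pm eps ee) => pe; rewrite pe in k; lia.
  split=> //; apply: (@mulIf _ q); first by apply/eqP; lia.
  by apply: (@addIr _ (- (p * s))); rewrite h ss h'.
have diff (eps : int) : eps * eps = 1 -> r * q - p * s = eps -> r' * q - p * s' = - eps ->
    False.
  move=> ee h h'.
  have k : q * (r * s' - r' * s) = eps * (s' + s).
    by transitivity ((r * q - p * s) * s' - (r' * q - p * s') * s);
      [ring | rewrite h h'; ring].
  have ssq : s + s' = q.
    case: (pm eps ee) => pe; rewrite pe in k.
      by have := mulz_tight k; lia.
    have k' : q * (- (r * s' - r' * s)) = s' + s by rewrite mulrN k mulN1r opprK.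
    by have := mulz_tight k'; lia.
  have u0 : u = 0 by lia.
  have u0' : u' = 0 by lia.
  have t1 : t = 1 by case: cg; lia.
  have t1' : t' = 1 by case: cg'; lia.
  by move: h h'; rewrite -E -E' u0 u0' t1 t1' !mulr0 !mul1r; lia.
rewrite E E' => /orP[]/eqP h /orP[]/eqP h'.
- exact: (same 1).
- by case: (diff 1).
- by case: (diff (-1)).
- exact: (same (-1)).
Qed.

Definition mkQhat (n d : int) : Qhat :=
  if d == 0 then None else fin_Qhat (n%:~R / d%:~R).

Lemma mkQhatK (g : Qhat) : in_Qhat0 g -> mkQhat (num g) (den g) = g.
Proof.
by case: g => [r|] //= _; rewrite /mkQhat denq_eq0 divq_num_den.
Qed.

Definition find_parents (c : Qhat) : option (Qhat * Qhat) :=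
  let m := `|den c|.+1 in
  let bg (x : 'I_m * 'I_m * ('I_m * 'I_m)) :=
    (mkQhat x.1.1%:Z x.1.2%:Z, mkQhat x.2.1%:Z x.2.2%:Z) in
  omap bg [pick x | parents c (bg x).1 (bg x).2].

Lemma find_parentsP c b g : find_parents c = Some (b, g) -> parents c b g.
Proof. by rewrite /find_parents; case: pickP => //= x h [<- <-]. Qed.

Lemma find_parents_eq c b g : parents c b g -> find_parents c = Some (b, g).
Proof.
move=> h; case e : (find_parents c) => [[b' g']|].
  by have [-> ->] := parents_uniq h (find_parentsP e).
have [hb hg hf [_ _ n1 d1] sb] := parentsP h.
case: (in_Qhat0_num hb) => nb db cb; case: (in_Qhat0_num hg) => ng dg cg.
move: e; rewrite /find_parents; case: pickP => //= hno _.
have o (k : int) : 0 <= k -> k <= den c -> exists i : 'I_(`|den c|.+1), (i : nat)%:Z = k.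
  move=> k0 k1; have hk : (`|k| < `|den c|.+1)%N by lia.
  by exists (Ordinal hk) => /=; lia.
have [x1 h1] := o (num b) nb ltac:(lia).
have [x2 h2] := o (den b) db ltac:(lia).
have [x3 h3] := o (num g) ng ltac:(lia).
have [x4 h4] := o (den g) dg ltac:(lia).
by have := hno ((x1, x2), (x3, x4)); rewrite /= h1 h2 h3 h4 !mkQhatK // h.
Qed.

Fixpoint QNrec (n : nat) (c : Qhat) : {poly int} * {poly int} :=
  let base := if c is None then (0, 1) else (1, 1) in
  if n is n'.+1 then
    if find_parents c is Some (b, g) then
      let q := (QNrec n' b).1 in
      let x := QNrec n' g in let y := QNrec n' (oplusn 1 g b) in
      (- dQ b * x.1 + q * y.1, - dQ b * x.2 + q * y.2)
    else base
  else base.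

Lemma QNrec_fuel n m c : (`|den c| <= n)%N -> (`|den c| <= m)%N -> QNrec n c = QNrec m c.
Proof.
have base c' : find_parents c' <> None -> (0 < `|den c'|)%N.
  case e : (find_parents c') => [[b g]|] // _.
  by have [_ _ _ [_ _ _ +] +] := parentsP (find_parentsP e);
    have := den_ge0 g; lia.
elim: n m c => [|n IH] [|m] c //= h1 h2.
- case e : (find_parents c) => [[b g]|] //.
  by have : (0 < `|den c|)%N; [apply: base; rewrite e | lia].
- case e : (find_parents c) => [[b g]|] //.
  by have : (0 < `|den c|)%N; [apply: base; rewrite e | lia].
case e : (find_parents c) => [[b g]|] //.
have [hb hg hf [_ d0 n1 d1] sb] := parentsP (find_parentsP e).
have dg := den_ge0 g.
have hp : 0 < den g + den b by lia.
by rewrite (IH m b) ?(IH m g) ?(IH m (oplusn 1 g b)) // ?d0; lia.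
Qed.

Lemma exists_QN : exists Q N, is_QN Q N.
Proof.
pose G c := QNrec `|den c| c.
have small c : (`|den c| <= 1)%N -> G c = if c is None then (0, 1) else (1, 1).
  rewrite /G => h; rewrite (@QNrec_fuel _ 1%N) //=.
  case e : (find_parents c) => [[b g]|] //.
  have [hb hg hf [_ d0 n1 d1] sb] := parentsP (find_parentsP e).
  by have := den_ge0 g; lia.
have step b g : in_Qhat0 b -> in_Qhat0 g -> farey_pair b g -> in_Q0 (oplusn 2 g b) ->
  G (oplusn 2 g b) = (- dQ b * (G g).1 + (G b).1 * (G (oplusn 1 g b)).1,
                      - dQ b * (G g).2 + (G b).1 * (G (oplusn 1 g b)).2).
  move=> hb hg hf hc.
  have p : parents (oplusn 2 g b) b g by apply/and5P; split.
  have [_ _ _ [_ d0 n1 d1] sb] := parentsP p; have dg := den_ge0 g.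
  have bn : (0 < `|den (oplusn 2 g b)|)%N by lia.
  rewrite {1}/G -(prednK bn) [QNrec _ _]/= (find_parents_eq p) /G.
  have e x : 0 <= den x -> den x < den (oplusn 2 g b) ->
      QNrec `|den (oplusn 2 g b)|.-1 x = QNrec `|den x| x.
    by move=> x0 x1; apply: QNrec_fuel; lia.
  by rewrite (e b) ?(e g) ?(e (oplusn 1 g b)) //; lia.
exists (fun c => (G c).1), (fun c => (G c).2); split; rewrite ?small //.
- by move=> b g *; rewrite step.
- by move=> b g *; rewrite step.
Qed.

Lemma exists_funnel_last (alpha : rat) : 0 < alpha < 1 ->
  exists m, funnel_last alpha m.
Proof.
move=> /andP[a0 a1].
have inv j : (forall i, (i < j)%N ->
      (funnel_edge alpha i).1 ⊕ (funnel_edge alpha i).2 <> alpha) ->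
    let e := funnel_edge alpha j in
    [/\ numq e.2 * denq e.1 - numq e.1 * denq e.2 = 1, e.1 < alpha, alpha < e.2 &
        j%:Z + 2 <= denq e.1 + denq e.2].
  elim: j => [|j IH] hj; first by split.
  have [h1 h2 h3 h4] := IH (fun i hi => hj i (leqW hi)).
  rewrite /= /funnel_step; move: (hj j (leqnn _)).
  move: h1 h2 h3 h4; case: (funnel_edge alpha j) => [L R] /= h1 h2 h3 h4.
  have dL := denq_gt0 L; have dR := denq_gt0 R.
  have hf : farey_pair R L by rewrite /farey_pair /= h1.
  have [e1 e2] := farey_oplus hf (addr_gt0 dL dR).
  rewrite /= in e1 e2 *.
  case: ltgtP => //= hc ne; [| | by case: ne]; (split=> //; rewrite ?e1 ?e2 -?h1; [ring | lia]).
have bound k e : numq e.2 * denq e.1 - numq e.1 * denq e.2 = 1 -> e.1 < alpha -> alpha < e.2 ->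
    k%:Z + 2 <= denq e.1 + denq e.2 -> k%:Z + 2 <= denq alpha.
  move=> h1; rewrite -(divq_num_den e.1) -(divq_num_den e.2) -(divq_num_den alpha).
  rewrite !divq_num_den.
  have lt (x y : rat) : (x < y) = (numq x * denq y < numq y * denq x).
    rewrite -{1}(divq_num_den x) -{1}(divq_num_den y).
    by rewrite ltr_pdivrMr ?ltr0z // mulrAC ltr_pdivlMr ?ltr0z // -!intrM ltr_int.
  rewrite !lt.
  move: h1 (denq_gt0 e.1) (denq_gt0 e.2) (denq_gt0 alpha).
  move: (numq e.1) (denq e.1) (numq e.2) (denq e.2) (numq alpha) (denq alpha).
  move=> a b c d p q h1 b0 d0 q0 h2 h3 h4.
  have : q = b * (c * q - p * d) + d * (p * b - a * q).
    by rewrite -{1}[q]mul1r -h1; ring.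
  by nia.
have [m hm] : exists m, (funnel_edge alpha m).1 ⊕ (funnel_edge alpha m).2 == alpha.
  have [/existsP[m hm]|/existsPn hno] := boolP [exists m : 'I_`|denq alpha|,
     (funnel_edge alpha m).1 ⊕ (funnel_edge alpha m).2 == alpha]; first by exists m.
  have [|h1 h2 h3 h4] := inv `|denq alpha|%N.
    by move=> i hi; apply/eqP; exact: (hno (Ordinal hi)).
  by have := bound _ _ h1 h2 h3 h4; have := denq_gt0 alpha; lia.
have exm : exists m, (funnel_edge alpha m).1 ⊕ (funnel_edge alpha m).2 == alpha by exists m.
exists (ex_minn exm); case: ex_minnP => k /eqP hk mk; split=> // j jk /eqP hj.
by have := mk j hj; lia.
Qed.

Lemma ehat_oplus (e : edge) : farey_pair e.1 e.2 -> denq e.1 != denq e.2 ->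
  ehat e ⊕ eminus e = eplus e.
Proof.
move=> hf hd.
have hf' : farey_pair (eminus e) (eplus e).
  rewrite /eminus /eplus; case: ifP => // _.
  by move: hf; rewrite /farey_pair /= orbC -opprB eqr_oppLR opprK eqr_oppLR.
have hlt : denq (eminus e) < denq (eplus e).
  by move: hd; rewrite /eminus /eplus; case: (ltgtP (denq e.1) (denq e.2)).
have [hn hd'] : numq (ehat e) = numq (eplus e) - numq (eminus e) /\
    denq (ehat e) = denq (eplus e) - denq (eminus e).
  rewrite /ehat; move: hf'; rewrite /farey_pair /= => /orP[]/eqP h.
    apply: (@numden_div _ _ (- denq (eminus e)) (numq (eminus e))); first by lia.
    by rewrite -h; ring.
  apply: (@numden_div _ _ (denq (eminus e)) (- numq (eminus e))); first by lia.
  by apply: oppr_inj; rewrite -h; ring.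
by rewrite /oplus /= hn hd' !subrK divq_num_den.
Qed.

(* Main.v *)
Require Import Defs.
From mathcomp Require Import all_boot all_order all_algebra finmap.
From mathcomp Require Import zify ring lra.
Set Implicit Arguments. Unset Strict Implicit. Unset Printing Implicit Defensive.
Import Order.TTheory GRing.Theory Num.Theory.
Local Open Scope ring_scope.

(** Write v(g) for the column vector (N(g), Q(g)), so that V(g) is the point of
    the projective line below v(g), write [v, w] for the determinant of two
    vectors, and let tau be the translation by -1.  With w = v(omega), the two
    matrices are

      T_omega v = d(omega) v + [v, w] w,
      S_omega (tau v) = d(omega) v - [v, w] w,

    that is, a scalar plus a multiple of w.  So T_omega fixes V(omega), and
    S_omega takes V(omega) - 1, the value that the triples attach to a left
    endpoint, to V(omega).  The image of any other vector depends only on its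
    determinant with w, and so the theorem reduces to knowing these determinants
    for neighbouring fractions.

    They are given by [wedge_relations]: for an edge L < R of the Farey tree with
    mediant c,

      Q(c) = Q(L) Q(R) - [v(L), v(R)],
      [v(L), v(c)] = d(L) Q(R),
      [v(c), v(R)] = d(R) Q(L).

    The three identities together are stable under passing from {L, R} to either
    child edge, because the recursion expresses the vector of the next mediant
    through v(L), v(R), v(c), and d is multiplicative along mediants.

    They determine what the matrix of a hub does to the three vertices of a
    triple.  It fixes the hub ([Smx_fixes_hub], [Tmx_fixes_hub]).  It moves a
    vertex two steps ahead in the fan of the hub ([Smx_advances],
    [Tmx_advances]).  Where the funnel turns to a new hub, the hat of the edge
    before the turn lies outside the new fan, and goes to the mediant of that
    edge ([Smx_turns], [Tmx_turns]).  In each case the recursion computes the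
    image vector up to a nonzero scalar.

    The label of a pair can be attached to the vertex opposite to the pair
    ([opposite_labels]).  The assertion then concerns three labelled points, and
    there are four cases for it: each of two consecutive edges of the funnel can
    be a left or a right child of the one before. *)

(** * Edges of the Farey tree *)

Inductive farey_edge : rat -> rat -> Prop :=
| FareyRoot : farey_edge 0 1
| FareyLeft L R : farey_edge L R -> farey_edge L (L ⊕ R)
| FareyRight L R : farey_edge L R -> farey_edge (L ⊕ R) R.

Lemma oplusC (g h : Qhat) : g ⊕ h = h ⊕ g.
Proof. by rewrite /oplus addrC [den g + _]addrC. Qed.

Lemma num_den_oplus (L R : rat) : numq R * denq L - numq L * denq R = 1 ->
  numq (L ⊕ R) = numq L + numq R /\ denq (L ⊕ R) = denq L + denq R.
Proof.
move=> h; have hf : farey_pair R L by rewrite /farey_pair /= h.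
exact: farey_oplus hf (addr_gt0 (denq_gt0 L) (denq_gt0 R)).
Qed.

Lemma farey_edgeP L R : farey_edge L R ->
  [/\ numq R * denq L - numq L * denq R = 1,
      0 <= numq L <= denq L & 0 <= numq R <= denq R].
Proof.
elim=> [|{}L {}R _ [h hL hR]|{}L {}R _ [h hL hR]] //.
- by have [-> ->] := num_den_oplus h; split=> //; lia.
- by have [-> ->] := num_den_oplus h; split=> //; lia.
Qed.

Lemma num_den_mediant L R : farey_edge L R ->
  numq (L ⊕ R) = numq L + numq R /\ denq (L ⊕ R) = denq L + denq R.
Proof. by case/farey_edgeP=> h _ _; exact: num_den_oplus. Qed.

Lemma mediant_neq L R : farey_edge L R ->
  ((L ⊕ R == L) = false) * ((L ⊕ R == R) = false).
Proof.
move=> h; have [_ hd] := num_den_mediant h.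
have := denq_gt0 L; have := denq_gt0 R.
by split; apply/eqP => /(congr1 denq); rewrite hd; lia.
Qed.

Lemma dQ_mediant L R : farey_edge L R -> dQ (L ⊕ R) = dQ L * dQ R.
Proof.
move=> h; have [h1 h2] := num_den_mediant h.
case/farey_edgeP: h => _ hL hR; rewrite /dQ /= h1 h2.
have -> : absz (numq L + numq R) = (absz (numq L) + absz (numq R))%N by lia.
have -> : absz (denq L + denq R) = (absz (denq L) + absz (denq R))%N by lia.
by rewrite !exprD -scalerAl -scalerAr scalerA.
Qed.

(** * The recursion along the Farey tree *)

(** Either endpoint of a tree edge can be the pivot b of the recursion, and the
    two choices compute the mediants of the two child edges. *)
Section Recursion.
Variables Q F : Qhat -> {poly int}.
Hypothesis hF : farey_recursive Q F.

Lemma farey_recursive_left L R : farey_edge L R ->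
  F (L ⊕ (L ⊕ R)) = - dQ L * F R + Q L * F (L ⊕ R).
Proof.
move=> h; have [h1 h2] := num_den_mediant h.
have [k1 k2] := num_den_mediant (FareyLeft h).
case/farey_edgeP: h => D hL hR.
have e2 : oplusn 2 R L = L ⊕ (L ⊕ R) by rewrite /oplusn /= (oplusC R) oplusC.
have e1 : oplusn 1 R L = L ⊕ R by rewrite /oplusn /= oplusC.
rewrite -e2 -e1; apply: hF; rewrite ?e2 /in_Qhat0 /in_Q0 /= ?in_Q0_num //.
  by rewrite /farey_pair /= -opprB D orbT.
by rewrite k1 k2 h1 h2; lia.
Qed.

Lemma farey_recursive_right L R : farey_edge L R ->
  F ((L ⊕ R) ⊕ R) = - dQ R * F L + Q R * F (L ⊕ R).
Proof.
move=> h; have [h1 h2] := num_den_mediant h.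
have [k1 k2] := num_den_mediant (FareyRight h).
case/farey_edgeP: h => D hL hR.
apply: (hF (b := R) (g := L)); rewrite /in_Qhat0 /in_Q0 /= ?in_Q0_num //.
  by rewrite /farey_pair /= D.
by rewrite k1 k2 h1 h2; lia.
Qed.

(** The recursion starts with the pair {0, oo}, which is not an edge of the
    tree and therefore needs its own instance. *)
Lemma farey_recursive_half :
  F ((0 : rat) ⊕ (1 : rat)) = - dQ (0 : rat) * F None + Q (0 : rat) * F (1 : rat).
Proof.
have e1 : oplusn 1 None (0 : rat) = (1 : rat) by congr Some; apply/eqP.
have e2 : oplusn 2 None (0 : rat) = (0 : rat) ⊕ (1 : rat) by congr Some; apply/eqP.
by rewrite -e2 -e1; apply: hF; rewrite ?e2.
Qed.

End Recursion.

(** Certificates for identities that hold modulo given ones: the right-hand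
    multipliers are supplied and the rest is a ring identity. *)
Lemma eq_comb (A : comPzRingType) (k u v x y : A) :
  u = v -> x - y = k * (u - v) -> x = y.
Proof. by move=> ->; rewrite subrr mulr0 => /eqP; rewrite subr_eq0 => /eqP. Qed.

Lemma eq_comb2 (A : comPzRingType) (k u v k' u' v' x y : A) :
  u = v -> u' = v' -> x - y = k * (u - v) + k' * (u' - v') -> x = y.
Proof. by move=> -> /eqP; rewrite -subr_eq0 => /eqP ->; rewrite mulr0 addr0; exact: eq_comb. Qed.

Section Values.
Variables Q N : Qhat -> {poly int}.
Hypothesis hQN : is_QN Q N.

Definition wedge (g h : Qhat) : {poly int} := N g * Q h - Q g * N h.

(** The three relations are proved together: for a child edge, each of them is
    a combination of those of the parent, once the recursion has
    replaced the new mediant.  At the root they come from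
    the initial values and d(1) = - d(0). *)
Lemma wedge_relations L R : farey_edge L R ->
  [/\ Q (L ⊕ R) = Q L * Q R - wedge L R,
      wedge L (L ⊕ R) = dQ L * Q R
    & wedge (L ⊕ R) R = dQ R * Q L].
Proof.
have QQ := QN_Qrec hQN; have QN := QN_Nrec hQN; rewrite /wedge.
elim=> [|{}L {}R h [I1 IL IR]|{}L {}R h [I1 IL IR]].
- rewrite !(farey_recursive_half QQ) !(farey_recursive_half QN).
  rewrite !(QN_Q0 hQN) !(QN_Q1 hQN) !(QN_Qinf hQN) !(QN_N0 hQN) !(QN_N1 hQN).
  rewrite (QN_Ninf hQN).
  have -> : dQ (1 : rat) = - dQ (0 : rat) by rewrite /dQ /= expr0 expr1 scale1r scaleN1r.
  by split; ring.
- rewrite (dQ_mediant h) !(farey_recursive_left QQ h).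
  rewrite !(farey_recursive_left QN h).
  split; first by apply: (eq_comb (k := 1) IL); ring.
    by apply: (eq_comb2 (k := Q L) (k' := - dQ L) IL I1); ring.
  by apply: (eq_comb (k := dQ L) IR); ring.
- rewrite (dQ_mediant h) !(farey_recursive_right QQ h).
  rewrite !(farey_recursive_right QN h).
  split; first by apply: (eq_comb (k := 1) IR); ring.
    by apply: (eq_comb (k := dQ R) IL); ring.
  by apply: (eq_comb2 (k := Q R) (k' := - dQ R) IR I1); ring.
Qed.

(** Reducing the recursion modulo x kills the term with d, since denominators are
    positive; so Q has constant term 1 throughout the tree.  In particular V is
    finite at all vertices of the tree. *)
Lemma Q_at_0 L R : farey_edge L R ->
  [/\ (Q L).[0] = 1, (Q R).[0] = 1 & (Q (L ⊕ R)).[0] = 1].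
Proof.
have QQ := QN_Qrec hQN.
have d0 (r : rat) : (dQ r).[0] = 0.
  by rewrite /dQ hornerZ hornerXn expr0n /=; case: eqP (denq_gt0 r) => [|_]; [lia | rewrite mulr0].
elim=> [|{}L {}R h [qL qR qc]|{}L {}R h [qL qR qc]].
- rewrite (farey_recursive_half QQ) (QN_Q0 hQN) (QN_Q1 hQN) (QN_Qinf hQN).
  by rewrite mulr0 add0r mulr1 hornerC.
- by split=> //; rewrite (farey_recursive_left QQ h)
    hornerD !hornerM hornerN d0 qL qc; ring.
- by split=> //; rewrite (farey_recursive_right QQ h)
    hornerD !hornerM hornerN d0 qR qc; ring.
Qed.

(** * Moebius action on the values V *)

Lemma toQxD : {morph toQx : p q / p + q}.
Proof. by move=> p q; rewrite /toQx !rmorphD. Qed.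
Lemma toQxM : {morph toQx : p q / p * q}.
Proof. by move=> p q; rewrite /toQx !rmorphM. Qed.
Lemma toQxN : {morph toQx : p / - p}.
Proof. by move=> p; rewrite /toQx !rmorphN. Qed.

Lemma toQx_eq0 p : (toQx p == 0) = (p == 0).
Proof.
rewrite /toQx tofrac_eq0; apply/eqP/eqP => [|->]; last by rewrite rmorph0.
move=> h; apply: (map_inj_poly (@intr_inj rat) (mulr0z _)).
by rewrite h rmorph0.
Qed.

Lemma dx_neq0 (r : rat) : toQx (dQ r) != 0.
Proof. by rewrite toQx_eq0 -size_poly_eq0 size_scale ?signr_eq0 // size_polyXn. Qed.

Lemma Qx_neq0 L R : farey_edge L R -> toQx (Q L) != 0 /\ toQx (Q R) != 0.
Proof.
case/Q_at_0=> qL qR _; rewrite !toQx_eq0.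
by split; apply/eqP=> q0; rewrite q0 horner0 in qL qR.
Qed.

Lemma mx2E (a b c d : Qx) : (mx2 a b c d 0 0 = a) * (mx2 a b c d 0 1 = b)
  * (mx2 a b c d 1 0 = c) * (mx2 a b c d 1 1 = d).
Proof. by rewrite !mxE. Qed.

(* The next three facts are stated over an abstract field, where, unlike in the
   field of fractions, there is nothing for conversion to unfold. *)
Lemma affine_quot (K : fieldType) (p q a b k c : K) :
  b != 0 -> p * a + q * b = k * c -> p * (a / b) + q = k / b * c.
Proof. by move=> b0 h; rewrite mulrAC -h; field. Qed.

Lemma scale_eq0 (K : fieldType) (k a : K) : k != 0 -> (k * a == 0) = (a == 0).
Proof. by move=> k0; rewrite mulf_eq0 (negPf k0). Qed.

Lemma scale_divf (K : fieldType) (k a b : K) : k != 0 -> k * a / (k * b) = a / b.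
Proof. by move=> k0; rewrite -mulf_div divff // mul1r. Qed.

Lemma quot_P1_scale (k a b : Qx) : k != 0 -> quot_P1 (k * a) (k * b) = quot_P1 a b.
Proof. by move=> k0; rewrite /quot_P1 (scale_eq0 _ k0) (scale_divf _ _ k0). Qed.

(** To compute a Moebius image it is enough to find the image vector up to a
    nonzero scalar k. *)
Lemma moebius_quot_P1 (A : 'M[Qx]_2) (k a b a' b' : Qx) : b != 0 -> k != 0 ->
  A 0 0 * a + A 0 1 * b = k * a' -> A 1 0 * a + A 1 1 * b = k * b' ->
  moebius A (quot_P1 a b) = quot_P1 a' b'.
Proof.
move=> b0 k0 ha hb; rewrite {1}/quot_P1 (negPf b0) /=.
rewrite (affine_quot b0 ha) (affine_quot b0 hb).
exact: quot_P1_scale (mulf_neq0 k0 (invr_neq0 b0)).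
Qed.

Lemma shift_quot_P1 (c a b : Qx) : shift_P1 c (quot_P1 a b) = quot_P1 (a + c * b) b.
Proof.
rewrite /quot_P1; case: eqP => //= /eqP b0.
by congr Some; rewrite mulrDl mulfK // addrC.
Qed.

Local Notation V := (calV Q N).
Local Notation V1 g := (shift_P1 (-1) (calV Q N g)).

(** The term [v, w] w vanishes at v = w. *)
Lemma Smx_fixes_hub L R : farey_edge L R -> moebius (Smx Q N L) (V1 L) = V L.
Proof.
move=> /Qx_neq0 [qL _]; rewrite /calV shift_quot_P1.
by apply: (moebius_quot_P1 (k := toQx (dQ L))); rewrite ?dx_neq0 // !mx2E; ring.
Qed.

Lemma Tmx_fixes_hub L R : farey_edge L R -> moebius (Tmx Q N R) (V R) = V R.
Proof.
move=> /Qx_neq0 [_ qR]; rewrite /calV.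
by apply: (moebius_quot_P1 (k := toQx (dQ R))); rewrite ?dx_neq0 // !mx2E; ring.
Qed.

(** As v(R) carries no translation, the determinant that enters is that of
    tau^-1 v(R) and v(L), which is Q(c) by the first relation.  Hence
    S_L v(R) = d(L) tau^-1 v(R) - Q(c) v(L), while the recursion reads
    - v(L + c) = d(L) v(R) - Q(L) v(c), with + for the mediant.  The second
    coordinates agree, and the first ones do by the value of [v(L), v(c)].  The
    mirror image, for T_R, has [tau v(L), v(R)] = - Q(c). *)
Lemma Smx_advances L R : farey_edge L R ->
  moebius (Smx Q N L) (V R) = V (L ⊕ (L ⊕ R)).
Proof.
move=> h; have [_ qR] := Qx_neq0 h; rewrite /calV.
have [/(congr1 toQx) I1 /(congr1 toQx) IL _] := wedge_relations h.
rewrite /wedge !(toQxD, toQxM, toQxN) in I1 IL.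
rewrite (farey_recursive_left (QN_Qrec hQN) h).
rewrite (farey_recursive_left (QN_Nrec hQN) h).
rewrite !(toQxD, toQxM, toQxN).
apply: (moebius_quot_P1 (k := -1)); rewrite ?oppr_eq0 ?oner_eq0 // !mx2E.
  by apply: (eq_comb2 (k := -1) (k' := toQx (N L)) IL I1); ring.
by apply: (eq_comb (k := toQx (Q L)) I1); ring.
Qed.

Lemma Tmx_advances L R : farey_edge L R ->
  moebius (Tmx Q N R) (V1 L) = V ((L ⊕ R) ⊕ R).
Proof.
move=> h; have [qL _] := Qx_neq0 h; rewrite /calV shift_quot_P1.
have [/(congr1 toQx) I1 _ /(congr1 toQx) IR] := wedge_relations h.
rewrite /wedge !(toQxD, toQxM, toQxN) in I1 IR.
rewrite (farey_recursive_right (QN_Qrec hQN) h).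
rewrite (farey_recursive_right (QN_Nrec hQN) h).
rewrite !(toQxD, toQxM, toQxN).
apply: (moebius_quot_P1 (k := -1)); rewrite ?oppr_eq0 ?oner_eq0 // !mx2E.
  by apply: (eq_comb2 (k := 1) (k' := toQx (N R)) IR I1); ring.
by apply: (eq_comb (k := toQx (Q R)) I1); ring.
Qed.

(** Let c be the mediant of H and R.  Then
    S_c (tau v(H)) = d(c) v(H) - [v(H), v(c)] v(c), and since d(c) = d(H) d(R) and
    [v(H), v(c)] = d(H) Q(R), this is - d(H) times the recursion with pivot R. *)
Lemma Smx_turns H R : farey_edge H R ->
  moebius (Smx Q N (H ⊕ R)) (V1 H) = V ((H ⊕ R) ⊕ R).
Proof.
move=> h; have [qH _] := Qx_neq0 h; rewrite /calV shift_quot_P1.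
have [/(congr1 toQx) I1 /(congr1 toQx) IL _] := wedge_relations h.
rewrite /wedge !(toQxD, toQxM, toQxN) in I1 IL.
rewrite (farey_recursive_right (QN_Qrec hQN) h).
rewrite (farey_recursive_right (QN_Nrec hQN) h).
rewrite /Smx (dQ_mediant h) !(toQxD, toQxM, toQxN).
apply: (moebius_quot_P1 (k := - toQx (dQ H))); rewrite ?oppr_eq0 ?dx_neq0 // !mx2E.
  by apply: (eq_comb (k := - toQx (N (H ⊕ R))) IL); ring.
by apply: (eq_comb (k := - toQx (Q (H ⊕ R))) IL); ring.
Qed.

Lemma Tmx_turns L H : farey_edge L H ->
  moebius (Tmx Q N (L ⊕ H)) (V H) = V (L ⊕ (L ⊕ H)).
Proof.
move=> h; have [_ qH] := Qx_neq0 h; rewrite /calV.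
have [/(congr1 toQx) I1 _ /(congr1 toQx) IR] := wedge_relations h.
rewrite /wedge !(toQxD, toQxM, toQxN) in I1 IR.
rewrite (farey_recursive_left (QN_Qrec hQN) h).
rewrite (farey_recursive_left (QN_Nrec hQN) h).
rewrite /Tmx (dQ_mediant h) !(toQxD, toQxM, toQxN).
apply: (moebius_quot_P1 (k := - toQx (dQ H))); rewrite ?oppr_eq0 ?dx_neq0 // !mx2E.
  by apply: (eq_comb (k := - toQx (N (L ⊕ H))) IR); ring.
by apply: (eq_comb (k := - toQx (Q (L ⊕ H))) IR); ring.
Qed.

Lemma calV_endpoints : V (0 : rat) = Some 1 /\ V (1 : rat) = Some 1.
Proof.
rewrite /calV (QN_N0 hQN) (QN_N1 hQN) (QN_Q0 hQN) (QN_Q1 hQN) /quot_P1.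
by rewrite toQx_eq0 oner_eq0 divff ?toQx_eq0 ?oner_eq0.
Qed.

(** On the first triple the hub 0 acts on infinity, which has Q = 0 and is thus out
    of reach of the lemmas above. *)
Lemma Smx0_infinity :
  moebius (Smx Q N (0 : rat)) None = V ((0 : rat) ⊕ (1 : rat)).
Proof.
rewrite /calV (farey_recursive_half (QN_Qrec hQN)).
rewrite (farey_recursive_half (QN_Nrec hQN)) /moebius !mx2E.
rewrite (QN_N0 hQN) (QN_N1 hQN) (QN_Q0 hQN) (QN_Q1 hQN) (QN_Qinf hQN) (QN_Ninf hQN).
have t1 : toQx 1 = 1 by rewrite /toQx !rmorph1.
have t0 : toQx 0 = 0 by rewrite /toQx !rmorph0.
rewrite !(toQxD, toQxM, toQxN, t0, t1).
have n10 : (-1 : Qx) != 0 by rewrite oppr_eq0 oner_eq0.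
rewrite -[RHS](quot_P1_scale _ _ n10); congr quot_P1; ring.
Qed.

End Values.

(** * Labelled triples *)

(** The label of each pair is carried by the vertex that the pair omits: [la]
    belongs to the pair without [a], and so on.  In this form a permutation of
    the vertices just permutes the labels along with them. *)
Definition opposite_labels (a b c : P1) (la lb lc : rat) : ltriple :=
  LTriple [fset a; b; c]%fset
    [fset ([fset a; b]%fset, lc); ([fset a; c]%fset, lb); ([fset b; c]%fset, la)]%fset.

Lemma opposite_labelsCA a b c la lb lc :
  opposite_labels a b c la lb lc = opposite_labels b a c lb la lc.
Proof.
rewrite /opposite_labels (fsetUC [fset a]%fset [fset b]%fset); congr LTriple.
by rewrite -!fsetUA; congr fsetU; rewrite fsetUC.
Qed.

Lemma opposite_labelsAC a b c la lb lc :
  opposite_labels a b c la lb lc = opposite_labels a c b la lc lb.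
Proof.
rewrite /opposite_labels (fsetUC [fset b]%fset [fset c]%fset) fsetUAC; congr LTriple.
by rewrite (fsetUC [fset (_, lc)]%fset).
Qed.

(** Reduces the assertion on sets of points and of labelled pairs to its three
    labelled vertices. *)
Lemma takes_opposite_labels f s a b c la lb lc a' b' c' la' lb' lc' :
  f a = a' -> f b = b' -> f c = c' -> s la = la' -> s lb = lb' -> s lc = lc' ->
  takes f s (opposite_labels a b c la lb lc) (opposite_labels a' b' c' la' lb' lc').
Proof.
move=> <- <- <- <- <- <-.
by split=> /=; rewrite !(imfsetU, imfset_fset1) /= ?(imfsetU, imfset_fset1).
Qed.

Lemma eminus_left L R : farey_edge L R ->
  [/\ eminus (L, L ⊕ R) = L, eplus (L, L ⊕ R) = L ⊕ R, ehat (L, L ⊕ R) = R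
    & nu (L, L ⊕ R) = -1].
Proof.
move=> h; have [hn hd] := num_den_mediant h.
have lt : denq L < denq (L ⊕ R) by rewrite hd; have := denq_gt0 R; lia.
have e1 : eminus (L, L ⊕ R) = L by rewrite /eminus lt.
have e2 : eplus (L, L ⊕ R) = L ⊕ R by rewrite /eplus lt.
split=> //; last by rewrite /nu e1 eqxx.
rewrite /ehat e1 e2 hn hd !(addrAC _ _ (- _)) !subrr !add0r.
exact: divq_num_den.
Qed.

Lemma eminus_right L R : farey_edge L R ->
  [/\ eminus (L ⊕ R, R) = R, eplus (L ⊕ R, R) = L ⊕ R, ehat (L ⊕ R, R) = L
    & nu (L ⊕ R, R) = 1].
Proof.
move=> h; have [hn hd] := num_den_mediant h.
have lt : denq (L ⊕ R) < denq R = false by rewrite hd; have := denq_gt0 L; lia.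
have e1 : eminus (L ⊕ R, R) = R by rewrite /eminus lt.
have e2 : eplus (L ⊕ R, R) = L ⊕ R by rewrite /eplus lt.
split=> //.
  by rewrite /ehat e1 e2 hn hd !addrK; exact: divq_num_den.
by rewrite /nu e1 /= eq_sym (mediant_neq h).
Qed.

(** In both triples of an edge, the vertices e^- and e^+ are opposite to the pairs
    labelled e^- and e^+.  The third vertex is opposite to the mediant in delta
    and to the hat of e in delta'. *)
Lemma delta_left Q N L R : farey_edge L R ->
  delta Q N (L, L ⊕ R) = opposite_labels (calV Q N R) (shift_P1 (-1) (calV Q N L))
    (calV Q N (L ⊕ R)) (L ⊕ (L ⊕ R)) L (L ⊕ R).
Proof.
move=> h; have [e1 e2 e3 e4] := eminus_left h.
rewrite /delta /delta_hat /delta_at e4 e1 e2 e3 /= eqxx (mediant_neq h).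
have -> : shift_P1 0 (calV Q N R) = calV Q N R.
  by case: (calV Q N R) => //= t; rewrite add0r.
by [].
Qed.

Lemma delta_right Q N L R : farey_edge L R ->
  delta Q N (L ⊕ R, R) = opposite_labels (shift_P1 (-1) (calV Q N L))
    (shift_P1 (-1) (calV Q N (L ⊕ R))) (calV Q N R) ((L ⊕ R) ⊕ R) (L ⊕ R) R.
Proof.
move=> h; have [e1 e2 e3 e4] := eminus_right h.
rewrite opposite_labelsAC /delta /delta_hat /delta_at e4 e1 e2 e3 /= eqxx.
rewrite (eq_sym R) (mediant_neq h).
by rewrite /opposite_labels (oplusC R) fsetUAC (fsetUC [fset calV Q N R]%fset).
Qed.

Lemma delta'_left Q N L R : farey_edge L R ->
  delta' Q N (L, L ⊕ R) = opposite_labels (calV Q N (L ⊕ (L ⊕ R))) (calV Q N L)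
    (calV Q N (L ⊕ R)) R L (L ⊕ R).
Proof. by move=> h; have [e1 e2 e3 _] := eminus_left h; rewrite /delta' e1 e2 e3. Qed.

Lemma delta'_right Q N L R : farey_edge L R ->
  delta' Q N (L ⊕ R, R) = opposite_labels (calV Q N ((L ⊕ R) ⊕ R)) (calV Q N R)
    (calV Q N (L ⊕ R)) L R (L ⊕ R).
Proof.
move=> h; have [e1 e2 e3 _] := eminus_right h.
by rewrite /delta' e1 e2 e3 (oplusC R).
Qed.

(** * The funnel and its hubs *)

Section Funnel.
Variable alpha : rat.
Local Notation fe := (funnel_edge alpha).

Lemma funnel_edge_step j : fe j.+1 = funnel_step alpha (fe j).
Proof. by []. Qed.

Lemma funnel_step_child L R :
  funnel_step alpha (L, R) = (L, L ⊕ R) \/ funnel_step alpha (L, R) = (L ⊕ R, R).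
Proof. by rewrite /funnel_step /=; case: ifP; [left | right]. Qed.

Lemma farey_funnel_edge j : farey_edge (fe j).1 (fe j).2.
Proof.
elim: j => [|j IH]; first exact: FareyRoot.
rewrite funnel_edge_step /funnel_step; case: ifP => _ /=.
  exact: FareyLeft.
exact: FareyRight.
Qed.

Lemma funnel_edge_around m j : 0 < alpha < 1 -> funnel_last alpha m ->
  (j <= m)%N -> (fe j).1 < alpha < (fe j).2.
Proof.
move=> a01 [_ hm]; elim: j => [|j IH] // jm.
have /andP[hL hR] := IH (ltnW jm); have := hm j jm.
rewrite funnel_edge_step /funnel_step; move: (_ ⊕ _) => c ne.
case: (ltgtP alpha c) => [h|h|e] /=; [by rewrite hL h | by rewrite h hR |].
by case: (ne (esym e)).
Qed.

(** A hub that is the left endpoint of one of its spokes is so for all of them,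
    because alpha lies strictly inside every edge: otherwise the hub would be
    both smaller and larger than alpha. *)
Lemma hub_left_spoke m j : 0 < alpha < 1 -> funnel_last alpha m ->
  (1 <= j <= m)%N ->
  hub_left alpha m (eminus (fe j)) = ((fe j).1 == eminus (fe j)).
Proof.
move=> a01 hm jm; apply/allP/idP => [H|/eqP e].
  have : j \in iota 1 m by rewrite mem_iota; lia.
  by move/H; rewrite /spoke jm eqxx.
move=> i _; apply/implyP=> /andP[im /eqP ei].
have /andP[hj _] := funnel_edge_around (j := j) a01 hm ltac:(lia).
have /andP[_ hi] := funnel_edge_around (j := i) a01 hm ltac:(lia).
move: ei; rewrite -e /eminus; case: ifP => _; first by move/eqP.
by move=> ei; move: hi; rewrite ei => /(lt_trans hj); rewrite ltxx.
Qed.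

Lemma first_funnel_edge : alpha < 1 / 2 -> fe 1 = (0, (0 : rat) ⊕ (1 : rat)).
Proof.
rewrite funnel_edge_step /funnel_step => lt.
by have -> : alpha < (fe 0).1 ⊕ (fe 0).2 by apply: lt_le_trans lt _.
Qed.

(** Past the root all endpoints lie in [0, 1/2].  Written with numerators and
    denominators this is a linear condition, inherited by mediants. *)
Lemma half_funnel_edge j : alpha < 1 / 2 ->
  [/\ 0 <= numq (fe j.+1).1, numq (fe j.+1).1 *+ 2 <= denq (fe j.+1).1,
      0 <= numq (fe j.+1).2 & numq (fe j.+1).2 *+ 2 <= denq (fe j.+1).2].
Proof.
move=> lt; elim: j => [|j].
  rewrite (first_funnel_edge lt) /=.
  by have [-> ->] := num_den_mediant FareyRoot.
have [hn hd] := num_den_mediant (farey_funnel_edge j.+1).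
rewrite (funnel_edge_step j.+1) /funnel_step.
by case: ifP => _ [h1 h2 h3 h4] /=; rewrite ?hn ?hd; split=> //; lia.
Qed.

(** The only integer in [0, 1/2] is 0, so 0 is the only hub of denominator 1 and
    comes first in the order. *)
Lemma hub1 m : alpha < 1 / 2 -> hub alpha m.+1 1 = 0.
Proof.
move=> lt; rewrite /hub /=.
have e1 : eminus (fe 1) = 0.
  by rewrite (first_funnel_edge lt); case: (eminus_left FareyRoot).
have r0 : 0 \in hubs alpha m.+1.
  by rewrite /hubs mem_sort mem_undup; apply/mapP; exists 1%N; rewrite ?e1 // mem_iota.
have srt : sorted (fun a b => denq a <= denq b) (hubs alpha m.+1).
  by apply: sort_sorted => x y; exact: le_total.
have hall x : x \in hubs alpha m.+1 -> denq x = 1 -> x = 0.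
  rewrite /hubs mem_sort mem_undup => /mapP[[|j]]; rewrite mem_iota // => _ -> d1.
  have [h1 h2 h3 h4] := half_funnel_edge j lt.
  apply/eqP; rewrite -numq_eq0; apply/eqP.
  by move: d1; rewrite /eminus; case: ifP => _ d1; lia.
case: (hubs alpha m.+1) r0 srt hall => [|x s] //= r0 srt hall.
apply: hall; first exact: mem_head.
have tr : transitive (fun a b : rat => denq a <= denq b) by move=> a b c; exact: le_trans.
move: r0; rewrite inE => /orP[/eqP <- //|xs].
have le1 : denq x <= 1 by exact: (allP (order_path_min tr srt) 0 xs).
have x0 := denq_gt0 x.
by apply/eqP; rewrite eq_le le1.
Qed.

End Funnel.

Theorem theorem5p25 (Q N : Qhat -> {poly int}) (hQN : is_QN Q N)
    (alpha : rat) (alpha_gt0 : 0 < alpha) (alpha_lt : alpha < 1 / 2)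
    (alpha_neq : alpha <> 1 / 3)
    (n : nat) (hn : funnel_last alpha n.+1) :
  (forall i j : nat,
      (1 <= i <= size (hubs alpha n.+1))%N ->
      (2 <= j <= n.+1)%N ->
      spoke alpha n.+1 j (hub alpha n.+1 i) ->
      takes (moebius (Amx Q N alpha n.+1 i)) id
        (delta Q N (funnel_edge alpha j.-1))
        (delta' Q N (funnel_edge alpha j)))
  /\ takes (moebius (Amx Q N alpha n.+1 1)) label_swap
       triple0 (delta' Q N (funnel_edge alpha 1)).
Proof.
have a01 : 0 < alpha < 1 by lra.
have Aspoke i j : spoke alpha n.+1 j (hub alpha n.+1 i) ->
    Amx Q N alpha n.+1 i =
      if (funnel_edge alpha j).1 == eminus (funnel_edge alpha j)
      then Smx Q N (eminus (funnel_edge alpha j))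
      else Tmx Q N (eminus (funnel_edge alpha j)).
  case/andP=> jn /eqP e; rewrite /Amx -e.
  by rewrite (hub_left_spoke a01 hn jn).
split.
  move=> i [|[|j]] // _ _ /Aspoke ->.
  rewrite [j.+2.-1]/= !funnel_edge_step.
  have := farey_funnel_edge alpha j.
  case: (funnel_edge alpha j) => L R /= h.
  have [->|->] := funnel_step_child alpha L R.
    have hL := FareyLeft h; rewrite (delta_left _ _ h).
    have [->|->] := funnel_step_child alpha L (L ⊕ R).
      have [-> _ _ _] := eminus_left hL; rewrite /= eqxx (delta'_left _ _ hL).
      (* With a left hub, the image of the right endpoint, which is the last
         vertex of delta, is the first vertex of delta'. *)
      rewrite opposite_labelsAC opposite_labelsCA opposite_labelsAC.
      apply: takes_opposite_labels => //.
      - exact: (Smx_advances hQN hL).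
      - exact: (Smx_fixes_hub hQN hL).
      - exact: (Smx_advances hQN h).
    have [-> _ _ _] := eminus_right hL.
    rewrite /= (mediant_neq hL) (delta'_right _ _ hL).
    (* With a right hub, it is the image of the left endpoint, the second vertex
       of delta, that is the first vertex of delta'. *)
    rewrite opposite_labelsCA opposite_labelsAC.
    apply: takes_opposite_labels => //.
    - exact: (Tmx_advances hQN hL).
    - exact: (Tmx_fixes_hub hQN hL).
    - exact: (Tmx_turns hQN h).
  have hR := FareyRight h; rewrite (delta_right _ _ h).
  have [->|->] := funnel_step_child alpha (L ⊕ R) R.
    have [-> _ _ _] := eminus_left hR; rewrite /= eqxx (delta'_left _ _ hR).
    rewrite opposite_labelsAC opposite_labelsCA opposite_labelsAC.
    apply: takes_opposite_labels => //.
    - exact: (Smx_advances hQN hR).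
    - exact: (Smx_fixes_hub hQN hR).
    - exact: (Smx_turns hQN h).
  have [-> _ _ _] := eminus_right hR.
  rewrite /= (mediant_neq hR) (delta'_right _ _ hR).
  rewrite opposite_labelsCA opposite_labelsAC.
  apply: takes_opposite_labels => //.
  - exact: (Tmx_advances hQN hR).
  - exact: (Tmx_fixes_hub hQN hR).
  - exact: (Tmx_advances hQN h).
have fe1 : funnel_edge alpha 1 = (0, (0 : rat) ⊕ (1 : rat)) by exact: first_funnel_edge.
have [e1 _ _ _] := eminus_left FareyRoot.
have -> : Amx Q N alpha n.+1 1 = Smx Q N (0 : rat).
  have := hub_left_spoke (j := 1) a01 hn isT.
  by rewrite fe1 e1 /= eqxx /Amx hub1 // => ->.
rewrite fe1 (delta'_left _ _ FareyRoot) opposite_labelsCA.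
(* 0 and 1 are V(0) - 1 and V(1), to which the general lemmas apply. *)
have [V0 V1] := calV_endpoints hQN.
apply: takes_opposite_labels => //.
- by rewrite -(Smx_fixes_hub hQN FareyRoot) V0 /= addNr.
- by rewrite -(Smx_advances hQN FareyRoot) V1.
- exact: Smx0_infinity.
Qed.
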